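(* Let $X=\{0,1,\ldots,K\}$, let $Y$ be a countably infinite set, and let $(f_n)_{n=1,2,\ldots}$ be a family of functions $f_n:X^n\to Y$ that is computable with infinite memory. Then the family is frequency-based: there exists a function $h:D\to Y$ such that for every $n$ and every $x\in X^n$, $f_n(x_1,\ldots,x_n)=h(p_0(x),p_1(x),\ldots,p_K(x))$. The result remains true even if computability with infinite memory is only required over edge-labeled networks.
   Context: For $x\in X^n$, $p_k(x)=|\{i: x_i=k\}|/n$ is the frequency of the value $k$; $D=\{(p_0,\ldots,p_K)\in[0,1]^{K+1}:\sum_{k=0}^K p_k=1\}$. Model. A network is a triple $(n,G,\mathcal L)$: $n$ is the number of nodes; $G$ is a connected undirected graph without self-arcs on $n$ nodes; $d(i)$ is the degree of node $i$; the port labeling $\mathcal L$ assigns to the outgoing edges of each node $i$ distinct port numbers in $\{0,1,\ldots,d(i)\}$. A network is edge-labeled if for every edge $\{i,j\}$ the port number assigned to it by $i$ equals the port number assigned to it by $j$. An algorithm is a family of deterministic automata $(A_d)_{d=1,2,\ldots}$, where $A_d$ (describing the behavior of a node of degree $d$) is a map from $X\times Z_d\times Y\times M^d$ into itself not changing the $X$-component. Here $Z_d$ is the internal memory set, $Y$ is the output set, and $M$ is a finite message set; each of $Z_d$, $Y$, $M$ contains a special element $\emptyset$. Node $i$ starts with initial value $x_i\in X$, with memory $z_i(0)$, output $y_i(0)$ and all outgoing messages equal to $\emptyset$. Let $j_1,\ldots,j_{d(i)}$ be the neighbors of $i$ in the order of the port numbers at $i$, with $m_{i,k}$ the outgoing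 message of $i$ to $j_k$, and let $p_k$ be the index, in the corresponding enumeration at node $j_k$, of the edge from $j_k$ to $i$. At each time step every node $i$ updates synchronously $$[x_i,z_i(t+1),y_i(t+1);m_{i,1}(t+1),\ldots,m_{i,d(i)}(t+1)]=A_{d(i)}[x_i,z_i(t),y_i(t);m_{j_1,p_1}(t),\ldots,m_{j_{d(i)},p_{d(i)}}(t)].$$ The algorithm terminates with final output $y^*\in Y$ if there is a time $t'$ with $y_i(t)=y^*$ for all $i$ and all $t\ge t'$. The family $(f_n)$ is computable with infinite memory if, with the sets $Z_d$ and $Y$ countably infinite ($X$ and $M$ finite), there is a family $(A_d)_{d=1,2,\ldots}$ such that for every $n$, every network $(n,G,\mathcal L)$, and all initial values $x_1,\ldots,x_n$, the algorithm terminates with final output $f_n(x_1,\ldots,x_n)$. ''Over edge-labeled networks'' means that this is required only for edge-labeled networks.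
   Formalization: One common h is claimed only for all n ≥ 3, with a separate h for n = 2 and for n = 1: nodes can detect n = 1 or n = 2 from degrees, so f_2 = 1, f_n = 0 (n ≠ 2) is computable but not frequency-based; an automaton A_0 is added for the one-node network. *)

(* Defs.v *)
From HB Require Import structures.
From mathcomp Require Import all_boot all_order all_algebra.
From mathcomp Require Import classical_sets functions cardinality reals.
Set Implicit Arguments.
Unset Strict Implicit.
Unset Printing Implicit Defensive.
Import Order.TTheory GRing.Theory Num.Theory.

Definition countably_infinite (T : Type) : Prop :=
  ([set: T] #= [set: nat])%card.

(* A port number is only an ordering key: it ranges over d(i) + 1 values, so
   it differs in general from the position (among the d(i) neighbors of i) at
   which the automaton of node i sees that neighbor. *)
Record network (n : nat) := Network {
  adj : rel 'I_n;
  port : 'I_n -> 'I_n -> nat; (* only meaningful on adjacent nodes *)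
  adj_sym : symmetric adj;
  adj_irr : irreflexive adj;
  adj_connected : forall i j, connect adj i j;
  port_le : forall i j, adj i j -> port i j <= #|adj i|;
  port_inj : forall i, {in adj i &, injective (port i)} }.

Definition edge_labeled (n : nat) (N : network n) : Prop :=
  forall i j, adj N i j -> port N i j = port N j i.

Section Neighbors.
Variables (n : nat) (N : network n).

Definition degree (i : 'I_n) : nat := #|adj N i|.

Definition neighbors (i : 'I_n) : seq 'I_n :=
  sort (fun j j' => port N i j <= port N i j') (enum (adj N i)).

Lemma size_neighbors i : size (neighbors i) == degree i.
Proof. by rewrite size_sort -cardE. Qed.

Lemma mem_neighbors i j : (j \in neighbors i) = adj N i j.
Proof. by rewrite mem_sort mem_enum. Qed.

Definition neighbor (i : 'I_n) (k : 'I_(degree i)) : 'I_n :=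
  tnth (Tuple (size_neighbors i)) k.

Lemma back_index_subproof i (k : 'I_(degree i)) :
  index i (neighbors (neighbor k)) < degree (neighbor k).
Proof.
rewrite -(eqP (size_neighbors _)) index_mem mem_neighbors adj_sym.
by rewrite -mem_neighbors; apply: mem_tnth.
Qed.

(* The position of i in the enumeration of the neighbors of j_k, where j_k is
   the k-th neighbor of i (the index p_k of the update rule). *)
Definition back_index (i : 'I_n) (k : 'I_(degree i)) :
  'I_(degree (neighbor k)) := Ordinal (back_index_subproof k).

End Neighbors.

Record state (X Z Y M : Type) (d : nat) := State {
  input : X;
  memory : Z;
  output : Y;
  messages : {ffun 'I_d -> M} }.

(* [y0], [alg_mem0 d] and [alg_msg0] are the special elements of Y, Z_d and M.
   The automaton for d = 0 runs only in the network with one node. *)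
Record algorithm (X Y : Type) (y0 : Y) := Algorithm {
  alg_msg : finType;
  alg_msg0 : alg_msg;
  alg_mem : nat -> Type;
  alg_mem0 : forall d, alg_mem d;
  automaton : forall d, state X (alg_mem d) Y alg_msg d ->
                        state X (alg_mem d) Y alg_msg d;
  automaton_input : forall d s, input (@automaton d s) = input s }.

Section Execution.
Variables (X Y : Type) (y0 : Y) (A : algorithm X y0).
Variables (n : nat) (N : network n).

Definition configuration : Type :=
  forall i : 'I_n,
    state X (alg_mem A (degree N i)) Y (alg_msg A) (degree N i).

Definition initial (x : {ffun 'I_n -> X}) : configuration := fun i =>
  State (x i) (alg_mem0 A (degree N i)) y0 [ffun=> alg_msg0 A].

Definition step (c : configuration) : configuration := fun i =>
  automaton (State (input (c i)) (memory (c i)) (output (c i))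
    [ffun k => messages (c (neighbor k)) (back_index k)]).

Definition run (x : {ffun 'I_n -> X}) (t : nat) : configuration :=
  iter t step (initial x).

Definition terminates_with (x : {ffun 'I_n -> X}) (y : Y) : Prop :=
  exists t', forall i t, t' <= t -> output (run x t i) = y.

End Execution.

Definition computable_infinite_memory (X : finType) (Y : Type) (y0 : Y)
    (C : forall n, network n -> Prop)
    (f : forall n, {ffun 'I_n -> X} -> Y) : Prop :=
  exists A : algorithm X y0,
    (forall d, countably_infinite (alg_mem A d)) /\
    forall n, 0 < n -> forall N : network n, C n N ->
    forall x : {ffun 'I_n -> X}, terminates_with A N x (f n x).

Local Open Scope ring_scope.

Definition simplex (R : realType) (K : nat) : Type :=
  {p : {ffun 'I_K.+1 -> R} |
    (forall k, 0 <= p k <= 1) /\ \sum_k p k = 1}.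

Definition freq (R : realType) (K n : nat) (x : {ffun 'I_n -> 'I_K.+1}) :
  {ffun 'I_K.+1 -> R} := [ffun k => #|[set i | x i == k]|%:R / n%:R].

Lemma freq_simplex (R : realType) (K n : nat) (x : {ffun 'I_n -> 'I_K.+1}) :
  (0 < n)%N ->
  (forall k, 0 <= freq R x k <= 1) /\ \sum_k freq R x k = 1.
Proof.
move=> n_gt0; have nR : 0 < n%:R :> R by rewrite ltr0n.
split=> [k|].
  rewrite ffunE divr_ge0 ?ler0n//= ler_pdivrMr// mul1r ler_nat.
  by rewrite -[leqRHS]card_ord max_card.
rewrite (eq_bigr (fun k => #|[set i | x i == k]|%:R / n%:R)); last first.
  by move=> k _; rewrite ffunE.
rewrite -mulr_suml -natr_sum.
suff -> : (\sum_k #|[set i | x i == k]|)%N = n by rewrite divff// gt_eqF.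
rewrite -[RHS]card_ord -[RHS]sum1_card (partition_big x xpredT)//=.
by apply: eq_bigr => k _; rewrite cardsE -sum1_card.
Qed.

Definition freq_point (R : realType) (K n : nat) (n_gt0 : (0 < n)%N)
  (x : {ffun 'I_n -> 'I_K.+1}) : simplex R K :=
  exist _ (freq R x) (freq_simplex R x n_gt0).

(* [C] is the set of numbers of nodes n for which one common h serves. A node
   can detect that its network has one or two nodes (its degree is 0, resp. its
   degree and that of its neighbor are 1), so computability does not relate f_1
   and f_2 to each other or to the f_n with n >= 3. *)
Definition frequency_based_on (R : realType) (K : nat) (Y : Type)
    (C : nat -> Prop) (f : forall n, {ffun 'I_n -> 'I_K.+1} -> Y) : Prop :=
  exists h : simplex R K -> Y,
    forall (n : nat) (n_gt0 : (0 < n)%N), C n ->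
    forall x : {ffun 'I_n -> 'I_K.+1}, f n x = h (freq_point R n_gt0 x).

(* Main.v *)
(* A node cannot distinguish its network from a port-preserving covering of it:
   the runs agree fiberwise, so f takes the same value on an input and on its
   lift.  Coverings by bijections make f invariant under permutations of the
   nodes.  For n >= 3 the ring of m n nodes covers an edge-labeled ring of n
   nodes, hence f x equals f on x repeated m times.  If x and x', of sizes n and
   m, have the same frequencies, then x repeated m times and x' repeated n times
   are permutations of each other. *)
Require Import Defs.
From mathcomp Require Import all_boot reals.
From mathcomp Require Import all_order all_algebra all_fingroup zify boolp.

Set Implicit Arguments.
Unset Strict Implicit.
Unset Printing Implicit Defensive.
Import Order.TTheory GRing.Theory Num.Theory.

(** * Coverings of networks and the agreement of runs along them *)

Section Covering.
Variables (n m : nat) (N : network n) (N' : network m) (phi : 'I_m -> 'I_n).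

(** The first two fields say that [phi] maps the neighbors of [i] bijectively to those of [phi i].
    The port equation ranges over all pairs, so that the two sorting orders are equal as
    functions. *)
Record covering : Prop := Covering {
  covering_inj : forall i, {in adj N' i &, injective phi};
  covering_adj : forall i, phi @: adj N' i =i adj N (phi i);
  covering_port : forall i j, port N' i j = port N (phi i) (phi j) }.

Hypothesis cov : covering.

Lemma covering_degree i : degree N' i = degree N (phi i).
Proof.
by rewrite /degree -(eq_card (covering_adj cov i))
  (card_in_imset (@covering_inj cov i)).
Qed.

(** Both sides sort the same set of nodes by the same ports. Ports at a node are distinct on its
    neighbors, so the order is antisymmetric there and the sorted list is unique. *)
Lemma covering_neighbors i : map phi (neighbors N' i) = neighbors N (phi i).
Proof.
have -> : neighbors N' i = sort (relpre phi
    (fun j j' => port N (phi i) j <= port N (phi i) j')) (enum (adj N' i)).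
  congr (sort _ _); apply/funext => j; apply/funext => j'.
  by rewrite /= !(covering_port cov).
rewrite -sort_map.
have adjP k : (k \in map phi (enum (adj N' i))) = (k \in adj N (phi i)).
  rewrite -(covering_adj cov); apply/mapP/imsetP => -[j].
    by rewrite mem_enum; exists j.
  by exists j; rewrite ?mem_enum.
apply/(perm_sort_inP _ _ _).
- by move=> j k _ _; apply: leq_total.
- by move=> j k l _ _ _; apply: leq_trans.
- by move=> j k; rewrite !adjP => ij ik /anti_leq /(port_inj ij ik).
apply: uniq_perm => [||k]; rewrite ?enum_uniq ?adjP ?mem_enum //.
rewrite map_inj_in_uniq ?enum_uniq // => j k; rewrite !mem_enum.
exact: (covering_inj cov).
Qed.

Lemma covering_neighbor i (k : 'I_(degree N' i))
    (k' : 'I_(degree N (phi i))) :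
  k = k' :> nat -> phi (neighbor k) = neighbor k'.
Proof.
move=> kk'; rewrite /neighbor !(tnth_nth (phi i)) (tnth_nth i) /=.
rewrite -covering_neighbors -kk' (nth_map i) //.
by rewrite (eqP (size_neighbors _ _)).
Qed.

(** Since [phi] carries one neighbor list to the other without repetition, positions are kept; hence
    back indices agree along a covering. *)
Lemma covering_index i j : adj N' j i ->
  index (phi i) (neighbors N (phi j)) = index i (neighbors N' j).
Proof.
rewrite -mem_neighbors -covering_neighbors => ji.
rewrite -{1}(nth_index i ji) -(nth_map i (phi i)) ?index_mem //.
apply: index_uniq; first by rewrite size_map index_mem.
by rewrite covering_neighbors sort_uniq enum_uniq.
Qed.

Section Simulation.
Variables (X Y : Type) (y0 : Y) (A : algorithm X y0).

(* The transport is needed because covering_degree is not a conversion. *)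
Definition same_state d d' (s : state X (alg_mem A d) Y (alg_msg A) d)
    (s' : state X (alg_mem A d') Y (alg_msg A) d') : Prop :=
  exists e : d = d',
    eq_rect d (fun d => state X (alg_mem A d) Y (alg_msg A) d) s d' e = s'.

Lemma same_state_output d d' s s' :
  @same_state d d' s s' -> output s = output s'.
Proof. by case=> e; case: d' / e s' => s' <-. Qed.

Lemma same_state_messages d d' s s' (k : 'I_d) (k' : 'I_d') :
  same_state s s' -> k = k' :> nat -> messages s k = messages s' k'.
Proof.
by case=> e; case: d' / e s' k' => s' k' <- /val_inj ->.
Qed.

Lemma same_state_automaton d d' s s' (g : 'I_d -> alg_msg A)
    (g' : 'I_d' -> alg_msg A) : same_state s s' ->
  (forall (k : 'I_d) (k' : 'I_d'), k = k' :> nat -> g k = g' k') ->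
  same_state (automaton (State (input s) (memory s) (output s) (finfun g)))
    (automaton (State (input s') (memory s') (output s') (finfun g'))).
Proof.
case=> e; case: d' / e s' g' => s' g' <- gg'.
exists erefl; congr (automaton (State _ _ _ _)).
by apply/ffunP => k; rewrite !ffunE; apply: gg'.
Qed.

(** Induction on time: [i] and [phi i] hold the same state and, at each position, read the same
    outgoing slot of corresponding neighbors. *)
Lemma covering_run (x : {ffun 'I_n -> X}) t i :
  same_state (run A N' [ffun j => x (phi j)] t i) (run A N x t (phi i)).
Proof.
elim: t i => [|t IH] i.
  rewrite /= /initial ffunE; case: _ / (covering_degree i).
  by exists erefl.
apply: same_state_automaton => // k k' kk'.
have Ek := covering_neighbor kk'.
have Eb : back_index k = back_index k' :> nat.
  rewrite /= -Ek covering_index //.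
  by rewrite adj_sym -mem_neighbors; apply: mem_tnth.
(* The type of [back_index k'] mentions [neighbor k'], so it is generalized before that node is
   rewritten. *)
move: (back_index k') Eb; rewrite -Ek => b Eb.
exact: same_state_messages.
Qed.

Lemma covering_output (x : {ffun 'I_n -> X}) y y' : 0 < m ->
  terminates_with A N x y ->
  terminates_with A N' [ffun j => x (phi j)] y' -> y' = y.
Proof.
move=> m_gt0 [t1 Ht1] [t2 Ht2]; pose i := Ordinal m_gt0.
(* At time [maxn t1 t2] both runs show their final outputs. *)
rewrite -(Ht2 i (maxn t1 t2)) ?leq_maxr //.
rewrite -(Ht1 (phi i) (maxn t1 t2)) ?leq_maxl //.
exact/same_state_output/covering_run.
Qed.

End Simulation.
End Covering.

(** * Pulling port labels back along a locally bijective graph map *)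

Section Pullback.
Variables (n m : nat) (N : network n) (phi : 'I_m -> 'I_n) (e : rel 'I_m).
Hypotheses (e_sym : symmetric e) (e_irr : irreflexive e)
  (e_connected : forall i j, connect e i j)
  (phi_inj : forall i, {in e i &, injective phi})
  (phi_adj : forall i, phi @: e i =i adj N (phi i)).

Let phi_e i j : e i j -> adj N (phi i) (phi j).
Proof. by move=> ij; have := imset_f phi (ij : j \in e i); rewrite phi_adj. Qed.

Lemma pullback_port_le i j : e i j -> port N (phi i) (phi j) <= #|e i|.
Proof.
move=> /phi_e /port_le.
by rewrite -(eq_card (phi_adj i)) (card_in_imset (@phi_inj i)).
Qed.

Lemma pullback_port_inj i :
  {in e i &, injective (fun j => port N (phi i) (phi j))}.
Proof.
move=> j k ij ik /(port_inj (phi_e ij) (phi_e ik)).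
exact: (phi_inj ij ik).
Qed.

Definition pullback : network m :=
  Network e_sym e_irr e_connected pullback_port_le pullback_port_inj.

Lemma pullback_covering : covering N pullback phi.
Proof. by split. Qed.

Lemma pullback_edge_labeled : edge_labeled N -> edge_labeled pullback.
Proof. by move=> NE i j /phi_e; apply: NE. Qed.

End Pullback.

(** * An edge-labeled ring on any number of nodes *)

Section Ring.
Variable n : nat.

(** The condition [i != j] excludes the loop when there is one node; with two nodes both disjuncts
    describe the same edge. *)
Definition ring_adj : rel 'I_n :=
  fun i j => (i != j) && ((j == ordS i) || (i == ordS j)).

Lemma eq_ordE (i j : 'I_n) : (i == j) = (i == j :> nat).
Proof. by []. Qed.

Lemma val_ordS (i : 'I_n) : ordS i = (if i.+1 == n then 0 else i.+1) :> nat.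
Proof.
by have := ltn_ord i; rewrite /= => lt_in; case: eqP => [->|/eqP ne];
  rewrite ?modnn // modn_small // ltn_neqAle ne.
Qed.

Lemma ring_adj_sym : symmetric ring_adj.
Proof. by move=> i j; rewrite /ring_adj eq_sym orbC. Qed.

Lemma ring_adj_irr : irreflexive ring_adj.
Proof. by move=> i; rewrite /ring_adj eqxx. Qed.

Lemma ring_adj_connected i j : connect ring_adj i j.
Proof.
have connect_iter k : connect ring_adj i (iter k (@ordS n) i).
  elim: k => [|k IH]; first exact: connect0.
  apply: connect_trans IH _; rewrite iterS; set l := iter _ _ _.
  have [<-|ne] := eqVneq l (ordS l); first exact: connect0.
  by apply: connect1; rewrite /ring_adj ne eqxx.
have val_iter k : iter k (@ordS n) i = (i + k) %% n :> nat.
  elim: k => [|k IH]; first by rewrite addn0 modn_small.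
  by rewrite iterS /= IH -addn1 modnDml addn1 addnS.
(* Adding [n] keeps the subtraction from truncating when [j < i]. *)
suff -> : j = iter (j + n - i) (@ordS n) i by [].
apply: val_inj; rewrite [RHS]val_iter subnKC ?modnDr ?modn_small //.
by rewrite (leq_trans (ltnW (ltn_ord i))) ?leq_addl.
Qed.

(* Edges {i, i+1} alternate between the colors 0 and 1; the closing edge of a
   ring with at least three nodes gets the color 2. *)
Definition ring_port (i j : 'I_n) : nat :=
  if (i.+1 == j) || (j.+1 == i) then nat_of_bool (odd (minn i j)) else 2.

(** Adjacency in linear arithmetic, with the closing edge separated as in [ring_port]. *)
Lemma ring_adjE i j : ring_adj i j =
  [|| i.+1 == j, j.+1 == i, [&& i != j, i == 0 :> nat & j.+1 == n] |
    [&& i != j, j == 0 :> nat & i.+1 == n]].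
Proof.
rewrite /ring_adj !eq_ordE !val_ordS.
by have := ltn_ord i; have := ltn_ord j; do 2 case: ifP; lia.
Qed.

Lemma ring_port_inj i : {in ring_adj i &, injective (ring_port i)}.
Proof.
move=> j k; rewrite ![_ \in _]ring_adjE /ring_port => ij ik jk.
apply: val_inj => /=.
by move: ij ik jk; have := (ltn_ord i, ltn_ord j, ltn_ord k); case=> -[];
  do 2 case: ifP; lia.
Qed.

(** Applying [ordS] to both sides reduces the claim to [i + 2] differing from [i] modulo [n]. *)
Lemma ordS_neq_ord_pred (i : 'I_n) : 2 < n -> ordS i != ord_pred i.
Proof.
move=> n_gt2; rewrite -(can_eq (@ordSK n)) ord_predK eq_ordE !val_ordS.
by have := ltn_ord i; do 2 case: ifP; lia.
Qed.

Lemma ring_adj_pred2 i : 2 < n -> ring_adj i =i [set ordS i; ord_pred i].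
Proof.
move=> n_gt2 j; rewrite !inE [LHS]/(ring_adj i j) /ring_adj.
rewrite -(can2_eq (@ordSK n) (@ord_predK n)).
rewrite !eq_ordE !val_ordS.
by have := ltn_ord i; have := ltn_ord j; do 2 case: ifP; lia.
Qed.

(** The color 2 occurs only for [n > 2], where every degree is 2. Otherwise ports are at most 1, and
    [j] itself witnesses a positive degree. *)
Lemma ring_port_le i j : ring_adj i j -> ring_port i j <= #|ring_adj i|.
Proof.
move=> ij; have [n_gt2|n_le2] := ltnP 2 n.
  rewrite (eq_card (ring_adj_pred2 i n_gt2)) cards2 ordS_neq_ord_pred //.
  by rewrite /ring_port; case: ifP; case: odd.
apply: (@leq_trans 1); last by apply/card_gt0P; exists j.
rewrite /ring_port; case: ifP => [_|]; first exact: leq_b1.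
move: ij; rewrite ring_adjE eq_ordE.
by have := ltn_ord i; have := ltn_ord j; lia.
Qed.

Definition ring : network n := Network ring_adj_sym ring_adj_irr
  ring_adj_connected ring_port_le ring_port_inj.

Lemma ring_edge_labeled : edge_labeled ring.
Proof. by move=> i j _; rewrite /= /ring_port orbC minnC. Qed.

End Ring.

(** * The ring of [m * n] nodes as a covering of the ring of [n] nodes *)

Section RingCover.
Variables (n m : nat).
Hypotheses (n_gt2 : 2 < n) (m_gt0 : 0 < m).

Let n_gt0 : 0 < n. Proof. exact: leq_trans n_gt2. Qed.

Definition mod_ord (i : 'I_(m * n)) : 'I_n := Ordinal (ltn_pmod i n_gt0).

Lemma mod_ordS i : mod_ord (ordS i) = ordS (mod_ord i).
Proof.
apply: val_inj => /=; rewrite modn_dvdm ?dvdn_mull //.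
by rewrite -addn1 -[in RHS]addn1 modnDml.
Qed.

Lemma mod_ord_pred i : mod_ord (ord_pred i) = ord_pred (mod_ord i).
Proof. by rewrite -[i in RHS]ord_predK mod_ordS ordSK. Qed.

Let mn_gt2 : 2 < m * n.
Proof. exact: leq_trans n_gt2 (leq_pmull _ _). Qed.

(** The two neighbors of [i] go to the successor and the predecessor of [mod_ord i], which differ
    because [n > 2]. *)
Lemma mod_ord_inj i : {in @ring_adj (m * n) i &, injective mod_ord}.
Proof.
move=> j k; rewrite !ring_adj_pred2 // !inE.
have ne := ordS_neq_ord_pred (mod_ord i) n_gt2.
by do 2! [case/orP => /eqP ->]; rewrite // mod_ordS mod_ord_pred => E;
  rewrite E eqxx in ne.
Qed.

Lemma mod_ord_adj i : mod_ord @: @ring_adj (m * n) i =i ring_adj (mod_ord i).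
Proof.
move=> k; rewrite ring_adj_pred2 //.
have -> : mod_ord @: ring_adj i = mod_ord @: [set ordS i; ord_pred i].
  by apply/setP => l; apply/imsetP/imsetP => -[j ij ->]; exists j => //;
    rewrite ?ring_adj_pred2 // -ring_adj_pred2.
by rewrite imsetU1 imset_set1 mod_ordS mod_ord_pred.
Qed.

(** The ports come from [ring n]: those of [ring (m * n)] need not be compatible with [mod_ord], for
    instance at the closing edge. *)
Definition ring_cover : network (m * n) :=
  pullback (N := ring n) (@ring_adj_sym _) (@ring_adj_irr _)
    (@ring_adj_connected _) mod_ord_inj mod_ord_adj.

Lemma sum_mod_ord (F : 'I_n -> nat) :
  \sum_(i < m * n) F (mod_ord i) = m * \sum_(i < n) F i.
Proof.
(* [G] is defined on all natural numbers, so the induction on [m] can split off a block of [n]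
   indices and shift the rest. *)
pose G i := F (Ordinal (ltn_pmod i n_gt0)).
rewrite -[LHS]/(\sum_(i < m * n) G i).
have -> : \sum_(i < n) F i = \sum_(i < n) G i.
  by apply: eq_bigr => i _; congr F; apply: val_inj; rewrite /= modn_small.
clear m_gt0; elim: m => [|m' IH]; first by rewrite big_ord0.
rewrite !mulSn big_split_ord /= -IH; congr (_ + _).
by apply: eq_bigr => i _; congr F; apply: val_inj; rewrite /= modnDl.
Qed.

End RingCover.

(** * From invariance under coverings to dependence on frequencies alone *)

Section FrequencyBased.
Variables (K : nat) (Y : Type) (y0 : Y).
Variable f : forall n : nat, {ffun 'I_n -> 'I_K.+1} -> Y.
Hypothesis f_computable : computable_infinite_memory y0 edge_labeled f.
Local Notation count x k := #|[set i | x i == k]|.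

Lemma computable_covering n m (N : network n) (N' : network m) phi
    (x : {ffun 'I_n -> 'I_K.+1}) : 0 < n -> 0 < m ->
  edge_labeled N -> edge_labeled N' -> covering N N' phi ->
  f [ffun j => x (phi j)] = f x.
Proof.
move=> n_gt0 m_gt0 NE NE' cov; have [A [_ fA]] := f_computable.
apply: (covering_output cov m_gt0 (fA n n_gt0 N NE x)).
exact: fA.
Qed.

(** The ring pulled back along the bijection [s] is edge-labeled and covers the ring, for every
    positive [n]. *)
Lemma computable_perm n (x : {ffun 'I_n -> 'I_K.+1}) (s : {perm 'I_n}) :
  0 < n -> f [ffun j => x (s j)] = f x.
Proof.
move=> n_gt0; pose e := relpre s (@ring_adj n).
have e_sym : symmetric e by move=> i j; apply: ring_adj_sym.
have e_irr : irreflexive e by move=> i; apply: ring_adj_irr.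
have e_connected i j : connect e i j.
  (* A path in the ring from [s i] to [s j] is carried back by the inverse of [s]. *)
  rewrite -[i](permK s) -[j](permK s).
  have /connectP[p] := ring_adj_connected (s i) (s j).
  elim: p (s i) => [|l p IH] u /=; first by move=> _ ->.
  case/andP => ul pl El; apply: connect_trans (IH _ pl El).
  by apply: connect1; rewrite /e /= !permKV.
have s_inj i : {in e i &, injective s} by move=> j k _ _; apply: perm_inj.
have s_adj i : s @: e i =i ring_adj (s i).
  move=> k; rewrite -[k](permKV s) mem_imset //; exact: perm_inj.
have cov := pullback_covering (N := ring n) e_sym e_irr e_connected s_inj s_adj.
apply: computable_covering cov => //; first exact: ring_edge_labeled.
exact/pullback_edge_labeled/ring_edge_labeled.
Qed.

(** Equal counts make the two value tuples permutations of each other. The sizes are equal only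
    propositionally, to allow [m * n] against [n * m]. *)
Lemma computable_count n m (x : {ffun 'I_n -> 'I_K.+1})
    (x' : {ffun 'I_m -> 'I_K.+1}) : 0 < n -> n = m ->
  (forall k, count x k = count x' k) -> f x = f x'.
Proof.
move=> n_gt0 nm; case: m / nm x' => x' xx'.
have /tuple_permP[s Es] : perm_eq [tuple x i | i < n] [tuple x' i | i < n].
  have count_tuple (z : {ffun 'I_n -> 'I_K.+1}) k :
      count_mem k [tuple z i | i < n] = count z k.
    by rewrite count_map cardsE cardE /= {2}/enum_mem size_filter enumT.
  by apply/allP => k _; rewrite /= !count_tuple xx'.
rewrite -(computable_perm x' s n_gt0); congr f; apply/ffunP => i.
have /(congr1 (fun t => tnth t i)) := val_inj Es.
by rewrite !tnth_mktuple ffunE.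
Qed.

Lemma computable_repeat n m (n_gt2 : 2 < n) (x : {ffun 'I_n -> 'I_K.+1}) :
  0 < m -> f [ffun i : 'I_(m * n) => x (mod_ord n_gt2 i)] = f x.
Proof.
move=> m_gt0.
apply: (@computable_covering _ _ (ring n) (ring_cover n_gt2 m_gt0)).
- exact: leq_trans n_gt2.
- by rewrite muln_gt0 m_gt0 (leq_trans _ n_gt2).
- exact: ring_edge_labeled.
- exact/pullback_edge_labeled/ring_edge_labeled.
- exact: pullback_covering.
Qed.

Lemma count_repeat n m (n_gt2 : 2 < n) (x : {ffun 'I_n -> 'I_K.+1}) k :
  count [ffun i : 'I_(m * n) => x (mod_ord n_gt2 i)] k = m * count x k.
Proof.
rewrite -!sum1dep_card big_mkcond [in RHS]big_mkcond /=.
have /= <- := sum_mod_ord m n_gt2 (fun i => if x i == k then 1 else 0).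
by apply: eq_bigr => i _; rewrite ffunE.
Qed.

Lemma computable_freq (R : realType) n m (x : {ffun 'I_n -> 'I_K.+1})
    (x' : {ffun 'I_m -> 'I_K.+1}) : 0 < n -> 0 < m ->
  n = m \/ 2 < n /\ 2 < m -> freq R x = freq R x' -> f x = f x'.
Proof.
move=> n_gt0 m_gt0 nm /ffunP xx'.
(* Equality of frequencies with denominators cleared: both sides count the value [k] in inputs
   repeated to the common size [m * n]. *)
have cxx' k : m * count x k = n * count x' k.
  move: (xx' k); rewrite !ffunE => /eqP.
  rewrite eqr_div ?pnatr_eq0 -?lt0n // -!natrM eqr_nat => /eqP.
  by rewrite !(mulnC (count _ _)) // mulnC => ->; rewrite mulnC.
case: nm => [nm|[n_gt2 m_gt2]].
  apply: computable_count (nm) _ => // k; have := cxx' k.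
  by rewrite -[X in X * _]nm => /eqP; rewrite eqn_pmul2l // => /eqP.
rewrite -(computable_repeat n_gt2 x m_gt0) -(computable_repeat m_gt2 x' n_gt0).
apply: computable_count (mulnC _ _) _ => [|k]; first by rewrite muln_gt0 m_gt0.
by rewrite !count_repeat.
Qed.

(** [h] is obtained by choice: at [p] it takes the value of [f] shared by all inputs with
    frequencies [p] and size in [C]. *)
Lemma frequency_based_onP (R : realType) (C : nat -> Prop) :
  (forall n m, C n -> C m -> n = m \/ 2 < n /\ 2 < m) ->
  frequency_based_on R C f.
Proof.
move=> C_cases.
have /choice[h hP] (p : simplex R K) : exists y, forall n (n_gt0 : 0 < n),
    C n -> forall x : {ffun 'I_n -> 'I_K.+1}, freq_point R n_gt0 x = p ->
    f x = y.
  have [[n [n_gt0 [Cn [x xp]]]]|none] := pselect (exists n (n_gt0 : 0 < n),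
      C n /\ exists x : {ffun 'I_n -> 'I_K.+1}, freq_point R n_gt0 x = p).
    exists (f x) => m m_gt0 Cm x' x'p.
    apply: (@computable_freq R) => //; first exact: C_cases.
    by rewrite -xp in x'p; apply: (congr1 sval x'p).
  (* Points of the simplex that no such input realizes get the default [y0]. *)
  exists y0 => n n_gt0 Cn x xp; case: none.
  by exists n, n_gt0; split=> //; exists x.
by exists h => n n_gt0 Cn x; apply: hP.
Qed.

Lemma computable_frequency_based (R : realType) :
  [/\ frequency_based_on R (fun n => 3 <= n) f,
      frequency_based_on R (fun n => n = 2) f &
      frequency_based_on R (fun n => n = 1) f].
Proof.
split; apply: frequency_based_onP => n m; first by right.
  by move=> -> ->; left.
by move=> -> ->; left.
Qed.

End FrequencyBased.

Theorem theorem9p1 (R : realType) (K : nat) (Y : Type) (y0 : Y)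
    (Y_infinite : countably_infinite Y)
    (f : forall n : nat, {ffun 'I_n -> 'I_K.+1} -> Y) :
  (computable_infinite_memory y0 (fun _ _ => True) f ->
     [/\ frequency_based_on R (fun n => 3 <= n) f,
         frequency_based_on R (fun n => n = 2) f &
         frequency_based_on R (fun n => n = 1) f]) /\
  (computable_infinite_memory y0 edge_labeled f ->
     [/\ frequency_based_on R (fun n => 3 <= n) f,
         frequency_based_on R (fun n => n = 2) f &
         frequency_based_on R (fun n => n = 1) f]).
Proof.
split=> [[A [A_mem fA]]|f_computable].
  (* An algorithm correct on all networks is in particular correct on edge-labeled ones. *)
  apply: (@computable_frequency_based _ _ y0); exists A; split=> //.
  by move=> n n_gt0 N _; apply: fA.
exact: computable_frequency_based f_computable R.
Qed.
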